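(* Let $G(N,S_N,f,A)^2$ be an $n$-person dual game. Suppose that, for every $i\in N$, $(S_i,\succcurlyeq_i)$ is a nonempty chain-complete poset, and let $S_N=\prod_{i\in N}S_i$ be equipped with the component-wise partial order $\succcurlyeq$. For $x\in S_N$ put $$\pi(x)=\{t\in S_N:\ f_i(z_i,x_{-i})\le f_i(t_i,x_{-i})\ \text{and}\ f_i((Az)_i,(Ax)_{-i})\le f_i((At)_i,(Ax)_{-i})\ \text{for every } i\in N \text{ and all } z\in S_N\}.$$ Suppose that the following conditions hold: (a) for every $i\in N$, $f_i$ is order-positive from $(S_i,\succcurlyeq_i)\times(S_{-i},\succcurlyeq_{-i})$ to $(\mathbb{R},\ge)$; (b) for every $x\in S_N$, $\pi(x)$ is a universally inductive subset of $S_N$; (c) the operator $A:S_N\to S_N$ is $\succcurlyeq$-increasing; (d) there are elements $x'\in S_N$ and $u'\in\pi(x')$ satisfying $x'\preccurlyeq u'$. Then the dual game $G(N,S_N,f,A)^2$ has a split Nash equilibrium. Moreover, writing $\mathcal{S}(G(N,S_N,f,A)^2)$ for the set of all its split Nash equilibria and $[x')=\{x\in S_N: x\succcurlyeq x'\}$: (i) $(\mathcal{S}(G(N,S_N,f,A)^2),\succcurlyeq)$ is a nonempty inductive poset; (ii) $(\mathcal{S}(G(N,S_N,f,A)^2)\cap[x'),\succcurlyeq)$ is a nonempty inductive poset.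
   Context: Games. Let $n\ge 2$ be an integer. An $n$-person game $G(N,S_N,f)$ consists of a set $N$ of $n$ players, a profile set $S_N=\prod_{i\in N}S_i$, where $S_i$ is the strategy set of player $i$, and $f=(f_i)_{i\in N}:S_N\to\mathbb{R}^n$, where $f_i:S_N\to\mathbb{R}$ is the utility function of player $i$. Write $S_{-i}=\prod_{k\in N\setminus\{i\}}S_k$; a profile $x\in S_N$ is written $x=(x_i,x_{-i})$ with $x_i\in S_i$, $x_{-i}\in S_{-i}$. Each $S_i$ is a poset $(S_i,\succcurlyeq_i)$; $\succcurlyeq$ denotes the component-wise partial order on $S_N$ ($y\succcurlyeq x$ iff $y_i\succcurlyeq_i x_i$ for all $i$), and $\succcurlyeq_{-i}$ the component-wise partial order on $S_{-i}$. Dual game. An $n$-person dual game $G(N,S_N,f,A)^2$ is an $n$-person game $G(N,S_N,f)$ together with a map $A:S_N\to S_N$. No linearity or continuity is assumed. Split Nash equilibrium. A split Nash equilibrium of $G(N,S_N,f,A)^2$ is a profile $\hat x\in S_N$ such that, for every $i\in N$ and every $z\in S_N$, $f_i(z_i,\hat x_{-i})\le f_i(\hat x_i,\hat x_{-i})$ and $f_i((Az)_i,(A\hat x)_{-i})\le f_i((A\hat x)_i,(A\hat x)_{-i})$. Order-positive. For posets $(X,\succcurlyeq^X)$, $(Y,\succcurlyeq^Y)$, $(U,\succcurlyeq^U)$, a map $g:X\times Y\to U$ is order-positive from $X\times Y$ to $U$ if, for all $x,y\in Y$ with $x\preccurlyeq^Y y$ and all $z,t\in X$, $g(z,x)\preccurlyeq^U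 g(t,x)$ implies $g(z,y)\preccurlyeq^U g(t,y)$. Increasing. $A:S_N\to S_N$ is $\succcurlyeq$-increasing if $x\preccurlyeq y$ implies $Ax\preccurlyeq Ay$. Order notions. A poset is chain-complete if every nonempty chain in it has a least upper bound in it. A poset is inductive if every nonempty chain in it has an upper bound in it. A nonempty subset $D$ of a poset $(P,\succcurlyeq)$ is universally inductive in $P$ if every nonempty chain $C\subseteq P$ such that each $c\in C$ satisfies $c\preccurlyeq d$ for some $d\in D$ has an upper bound belonging to $D$. *)

(* Defs.v *)
From HB Require Import structures.
From mathcomp Require Import all_boot all_order all_algebra.
From mathcomp Require Import boolp classical_sets reals.

Set Implicit Arguments.
Unset Strict Implicit.
Unset Printing Implicit Defensive.

Import Order.TTheory.

Local Open Scope classical_set_scope.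
Local Open Scope order_scope.

Definition chain d (T : porderType d) (C : set T) : Prop := total_on C <=%O.

Definition chain_complete d (T : porderType d) : Prop :=
  forall C : set T, C !=set0 -> chain C -> exists s : T, isLub C s.

(* [D] is regarded as a poset with the order inherited from [T]; the upper
   bound is therefore required to lie in [D] *)
Definition inductive d (T : porderType d) (D : set T) : Prop :=
  forall C : set T, C `<=` D -> C !=set0 -> chain C ->
    exists2 u : T, D u & ubound C u.

(* the chain [C] ranges over all of [T] and need not be contained in [D] *)
Definition universally_inductive d (T : porderType d) (D : set T) : Prop :=
  D !=set0 /\
  forall C : set T, C !=set0 -> chain C ->
    (forall c, C c -> exists2 x, D x & c <= x) ->
    exists2 u : T, D u & ubound C u.

Definition order_positive dX dY dU
    (X : porderType dX) (Y : porderType dY) (U : porderType dU)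
    (g : X * Y -> U) : Prop :=
  forall x y : Y, x <= y ->
  forall z t : X, g (z, x) <= g (t, x) -> g (z, y) <= g (t, y).

(* The product of a family of posets with the component-wise order. It is a
   named constant so that the order below is the one found by inference. *)
Definition profile (I : Type) d (S : I -> porderType d) : Type :=
  forall i : I, S i.

Fact profile_display : Order.disp_t.
Proof. exact: (Order.Disp tt tt). Qed.

Section ProfileOrder.
Variables (I : Type) (d : Order.disp_t) (S : I -> porderType d).
Implicit Types x y z : profile S.

HB.instance Definition _ :=
  Choice.copy (profile S) (forall i : I, (S i : choiceType)).

Definition le_profile x y : bool := `[< forall i, x i <= y i >].

Fact le_profile_refl : reflexive le_profile.
Proof. by move=> x; apply/asboolP => i. Qed.

Fact le_profile_anti : antisymmetric le_profile.
Proof.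
move=> x y /andP[/asboolP xy /asboolP yx]; apply: functional_extensionality_dep.
by move=> i; apply/eqP; rewrite eq_le xy yx.
Qed.

Fact le_profile_trans : transitive le_profile.
Proof.
move=> y x z /asboolP xy /asboolP yz; apply/asboolP => i.
exact: le_trans (xy i) (yz i).
Qed.

HB.instance Definition _ := Order.Le_isPOrder.Build profile_display (profile S)
  le_profile_refl le_profile_anti le_profile_trans.

Lemma le_profileP x y : reflect (forall i, x i <= y i) (x <= y).
Proof. exact: asboolP. Qed.

End ProfileOrder.

Section Games.
Variables (R : realType) (N : finType) (d : Order.disp_t).
Variable S : N -> porderType d.

Definition others_profile (i : N) : Type :=
  profile (fun k : {k : N | k != i} => S (val k)).

HB.instance Definition _ i := Order.POrder.copy (others_profile i)
  (profile (fun k : {k : N | k != i} => S (val k))).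

Definition others (i : N) (x : profile S) : others_profile i :=
  fun k => x (val k).
Arguments others i x : clear implicits.

(* the profile (s, y), for s in S_i and y in S_{-i} *)
Definition combine (i : N) (s : S i) (y : others_profile i) : profile S :=
  fun k => match k =P i with
           | ReflectT e => ecast j (S j) (esym e) s
           | ReflectF ne => y (exist _ k (contra_not_neq id ne))
           end.

Lemma combine_others (i : N) (s : S i) (x : profile S) :
  combine s (others i x) = dfwith x s.
Proof.
apply: functional_extensionality_dep => k; rewrite /combine.
case: (k =P i) => [e|ne]; first by case: _ / (esym e); rewrite dfwith_in.
by rewrite dfwith_out // eq_sym; apply/eqP.
Qed.

Lemma combineK (i : N) (x : profile S) : combine (x i) (others i x) = x.
Proof.
rewrite combine_others; apply: functional_extensionality_dep => k.
by case: dfwithP.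
Qed.

Variables (f : N -> profile S -> R) (A : profile S -> profile S).

Definition split_nash : set (profile S) :=
  [set x | forall (i : N) (z : profile S),
     (f i (combine (z i) (others i x)) <= f i (combine (x i) (others i x)))%R /\
     (f i (combine (A z i) (others i (A x))) <=
      f i (combine (A x i) (others i (A x))))%R].

Definition split_best_response (x : profile S) : set (profile S) :=
  [set t | forall (i : N) (z : profile S),
     (f i (combine (z i) (others i x)) <= f i (combine (t i) (others i x)))%R /\
     (f i (combine (A z i) (others i (A x))) <=
      f i (combine (A t i) (others i (A x))))%R].

End Games.

Arguments others {N d S} i x.

(* Main.v *)
(* Order-positivity and monotonicity of A make the split best response isotone
   for inclusion. Hence x <= u with u in the best response to x puts u in the
   best response to itself, so u is an equilibrium; in particular u' is one.
   Given a chain C of equilibria, let s be its supremum: every member of C lies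
   in the best response to s, so universal inductivity yields a best response
   u to s bounding C, whence s <= u and u is an equilibrium. *)
Require Import Defs.
From HB Require Import structures.
From mathcomp Require Import all_boot all_order all_algebra.
From mathcomp Require Import boolp classical_sets reals.

Local Open Scope classical_set_scope.
Local Open Scope order_scope.

(** Suprema are taken coordinate by coordinate: comparable profiles have comparable coordinates, so
    each projection of a chain is a chain, and choice assembles the suprema into one profile. *)
Lemma chain_complete_profile (I : Type) d (S : I -> porderType d) :
  (forall i, chain_complete (S i)) -> chain_complete (profile S).
Proof.
move=> hS C [c0 Cc0] chC.
have lubE i : exists s : S i, isLub [set x i | x in C] s.
  apply: hS; first by exists (c0 i), c0.
  move=> _ _ [x Cx <-] [y Cy <-].
  by have [/le_profileP xy|/le_profileP yx] := chC x y Cx Cy; [left|right].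
pose s : profile S := fun i => projT1 (cid (lubE i)).
have s_lub i : isLub [set x i | x in C] (s i) := projT2 (cid (lubE i)).
exists s; split=> [x Cx|y Cy].
  by apply/le_profileP => i; apply: (s_lub i).1; exists x.
apply/le_profileP => i; apply: (s_lub i).2 => _ [x Cx <-].
exact: (elimT (le_profileP _ _) (Cy x Cx)).
Qed.

Lemma le_others (N : finType) d (S : N -> porderType d) (i : N)
  (x y : profile S) : x <= y -> others i x <= others i y.
Proof. by move=> /le_profileP xy; apply/le_profileP => k; apply: xy. Qed.

(** Order-positivity of [f i] is used twice: along [x <= y], then along [A x <= A y] with [A z i]
    and [A t i] as own strategies. *)
Lemma split_best_response_sub (R : realType) (N : finType) d
  (S : N -> porderType d) (f : N -> profile S -> R)
  (A : profile S -> profile S)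
  (ha : forall i : N,
     order_positive (fun p : S i * others_profile S i => f i (combine p.1 p.2)))
  (hc : forall x y : profile S, x <= y -> A x <= A y) (x y : profile S) :
  x <= y -> split_best_response f A x `<=` split_best_response f A y.
Proof.
move=> xy t xt i z; have [le1 le2] := xt i z; split.
  exact: (ha i _ _ (le_others _ _ _ i _ _ xy) (z i) (t i) le1).
exact: (ha i _ _ (le_others _ _ _ i _ _ (hc _ _ xy)) (A z i) (A t i) le2).
Qed.

Theorem theorem1 (R : realType) (n : nat) (hn : (2 <= n)%N)
  (N : finType) (hN : #|N| = n)
  (d : Order.disp_t) (S : N -> porderType d)
  (f : N -> profile S -> R) (A : profile S -> profile S)
  (hS : forall i : N, [set: S i] !=set0 /\ chain_complete (S i))
  (ha : forall i : N,
     order_positive (fun p : S i * others_profile S i => f i (combine p.1 p.2)))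
  (hb : forall x : profile S,
     universally_inductive (split_best_response f A x))
  (hc : forall x y : profile S, x <= y -> A x <= A y)
  (x' u' : profile S) (hu' : split_best_response f A x' u') (hd : x' <= u') :
  (exists x : profile S, split_nash f A x) /\
  (split_nash f A !=set0 /\ inductive (split_nash f A)) /\
  (split_nash f A `&` [set x | x' <= x] !=set0 /\
   inductive (split_nash f A `&` [set x | x' <= x])).
Proof.
have Psub := split_best_response_sub _ _ _ _ _ _ ha hc.
(* By conversion, [split_nash f A u] is the fixed-point condition [split_best_response f A u u]. *)
have nash_of_ge x u : x <= u -> split_best_response f A x u -> split_nash f A u.
  by move=> xu; apply: Psub.
have bound C : C `<=` split_nash f A -> C !=set0 -> chain C ->
    exists2 u, split_nash f A u & ubound C u.
  move=> Csub C0 chC.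
  have [s [sub sleast]] :=
    chain_complete_profile _ _ _ (fun i => (hS i).2) C C0 chC.
  have [|u su Cu] := (hb s).2 C C0 chC.
    (* The dominating element is [c] itself: a best response to [c], hence to [s] since [c <= s]. *)
    by move=> c Cc; exists c => //; apply: (Psub c) (Csub c Cc); apply: sub.
  by exists u => //; apply: (nash_of_ge _ _ _ su); apply: sleast.
have u'_eq : split_nash f A u' := nash_of_ge _ _ hd hu'.
split; [by exists u'|split; split; [by exists u'|exact: bound|by exists u'|]].
move=> C Csub [c Cc] chC.
(* The bound among all equilibria already lies above [x'], because [x' <= c <= u] for the chosen [c]
   in the chain. *)
have [|u u_eq Cu] := bound C _ (ex_intro _ c Cc) chC.
  by move=> x /Csub[].
exists u => //; split=> //=.
exact: Order.POrderTheory.le_trans (Csub c Cc).2 (Cu c Cc).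
Qed.
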